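(* Let $a\in\mathbb Z$, $b\in\{0,1\}$, $x\in\mathbb Z\setminus\{0\}$, $\sigma\in\{1,-1\}$, $r\in\mathbb Q\setminus\{0\}$, and suppose that $$\alpha= r\left(\frac{x+\sqrt{x^2+4\sigma}}{2}\right)^{a}\left(\sqrt{x^2+4\sigma}\right)^{b}$$ is a positive real quadratic irrational number. Then for every $\varepsilon>0$ there is $C>0$ such that $\delta_{\min}^{(\alpha)}(N)\le C N^{-1+\varepsilon}$ for infinitely many integers $N$.
   Context: For irrational $\alpha>0$, the numbers $\alpha m^2+n^2$ with integers $m,n\ge 1$ are pairwise distinct; list them in increasing order as $0<\lambda_1<\lambda_2<\cdots$. For $N\ge 2$ define $\delta_{\min}^{(\alpha)}(N)=\min\{\lambda_{i+1}-\lambda_i : 1\le i<N\}$. *)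

(* Defs.v *)
From Stdlib Require Import Reals QArith Qreals ClassicalEpsilon List Lia.
Open Scope R_scope.

Definition is_value (alpha t : R) : Prop :=
  exists m n : nat, (1 <= m)%nat /\ (1 <= n)%nat /\
    t = alpha * (INR m) ^ 2 + (INR n) ^ 2.

(* A bound K with: alpha*m^2 + n^2 < t, m,n >= 1  ==>  m, n <= K (for alpha > 0). *)
Definition bnd (alpha t : R) : nat :=
  (Z.to_nat (up (sqrt (t / alpha))) + Z.to_nat (up (sqrt t)))%nat.

(* Number of pairs (m,n), m,n >= 1, with alpha*m^2 + n^2 < t (for alpha > 0).
   For irrational alpha the pairs give pairwise distinct values, so this is
   the number of values lambda_i strictly below t. *)
Definition count_below (alpha t : R) : nat :=
  let K := bnd alpha t in
  length (filter (fun p : nat * nat =>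
            if Rlt_dec (alpha * (INR (fst p)) ^ 2 + (INR (snd p)) ^ 2) t
            then true else false)
          (list_prod (seq 1 K) (seq 1 K))).

Definition is_lambda (alpha : R) (k : nat) (t : R) : Prop :=
  is_value alpha t /\ (count_below alpha t + 1)%nat = k.

Definition lambda (alpha : R) (k : nat) : R :=
  epsilon (inhabits 0) (is_lambda alpha k).

Definition gap (alpha : R) (i : nat) : R := lambda alpha (S i) - lambda alpha i.

(* delta_min(N) = min { lambda_{i+1} - lambda_i : 1 <= i < N }, for N >= 2. *)
Definition delta_min (alpha : R) (N : nat) : R :=
  fold_left Rmin (map (gap alpha) (seq 2 (N - 2))) (gap alpha 1).

Definition quadratic_irrational (alpha : R) : Prop :=
  (forall q : Q, alpha <> Q2R q) /\
  exists p q s : Z, (p <> 0%Z) /\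
    IZR p * alpha ^ 2 + IZR q * alpha + IZR s = 0.

(* Main.v *)
(* For close values alpha m^2 + n^2 one needs a good approximation of alpha by a quotient of
   integers each of which factors into two parts of nearly equal size.  Let h > 1 be the unit,
   h' its conjugate (h h' = -sigma), and U, V the Lucas sequences (h^n - h'^n)/(h - h') and
   h^n + h'^n.  Up to a rational factor alpha is approximated by U_(n+a)/W_n with error
   O(h^(-2n)), where W = U if b = 0 and W = V if b = 1.  If n + a = 2m then
   U_2m = U_m V_m is perfectly balanced.  To split W_n, take n = k L with
   L = F_0 ... F_(j-1) = F_j - 2 a product of Fermat numbers: by strong divisibility of W, the
   lcm of the W_(n/F_i) divides W_n and has size about h^(n (1 - prod (1 - 1/F_i))), and
   prod (1 - 1/F_i) = (1 + 1/L)/2 tends to 1/2. *)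
Require Import Defs.
From Stdlib Require Import Reals QArith Qreals ClassicalEpsilon List Lia.
From Stdlib Require Import ZArith Lra.
Open Scope R_scope.

(** * Balanced factorization in strongly divisible sequences *)

Lemma Zlcm_mul_gcd (a b : Z) : (Z.lcm a b * Z.gcd a b = Z.abs (a * b))%Z.
Proof.
  unfold Z.lcm. destruct (Z.eq_dec (Z.gcd a b) 0) as [E|E].
  - rewrite E. apply Z.gcd_eq_0_l in E. rewrite E. simpl. lia.
  - assert (Hq : (Z.gcd a b * (b / Z.gcd a b) = b)%Z).
    { symmetry. apply Z.div_exact; [exact E|].
      apply Z.mod_divide; [exact E|apply Z.gcd_divide_r]. }
    rewrite <- (Z.abs_eq (Z.gcd a b)) at 2 by apply Z.gcd_nonneg.
    rewrite <- Z.abs_mul, <- Z.mul_assoc, (Z.mul_comm (b / _)), Hq. reflexivity.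
Qed.

(** The divisibility lattice of the integers is distributive, also at 0. For the nontrivial
    direction [a] is first replaced by d = gcd(a, lcm(b, c)), which divides lcm(b, c). *)
Lemma Zgcd_lcm_distr (a b c : Z) :
  Z.gcd a (Z.lcm b c) = Z.lcm (Z.gcd a b) (Z.gcd a c).
Proof.
  apply Z.divide_antisym_nonneg;
    [apply Z.gcd_nonneg | apply Z.lcm_nonneg | | ].
  - set (d := Z.gcd a (Z.lcm b c)).
    assert (Hda : (d | a)%Z) by apply Z.gcd_divide_l.
    assert (Hdl : (d | Z.lcm b c)%Z) by apply Z.gcd_divide_r.
    assert (H : (d | Z.lcm (Z.gcd d b) (Z.gcd d c))%Z).
    { destruct (Z.eq_dec d 0) as [E|Hd].
      { rewrite E in *. apply Z.divide_0_l, Z.lcm_eq_0 in Hdl.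
        exists 0%Z. rewrite Z.mul_0_r.
        destruct Hdl as [-> | ->]; simpl; [reflexivity | apply Z.lcm_0_r]. }
      (* With u = gcd(d,b), v = gcd(d,c) and g = gcd(u,v), the claim is d g | u v,
         and Bezout reduces it to d g | d^2, d c, d b, b c. *)
      set (u := Z.gcd d b). set (v := Z.gcd d c).
      set (g := Z.gcd u v).
      assert (Hg : g <> 0%Z).
      { unfold g, u. intro E. apply Z.gcd_eq_0_l in E.
        apply Z.gcd_eq_0_l in E. contradiction. }
      apply (Z.mul_divide_cancel_r d (Z.lcm u v) g Hg).
      unfold g at 2. rewrite Zlcm_mul_gcd, Z.abs_eq
        by (apply Z.mul_nonneg_nonneg; apply Z.gcd_nonneg).
      assert (gd : (g | d)%Z).
      { apply Z.divide_trans with u; apply Z.gcd_divide_l. }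
      assert (gb : (g | b)%Z).
      { apply Z.divide_trans with u; [apply Z.gcd_divide_l|apply Z.gcd_divide_r]. }
      assert (gc : (g | c)%Z).
      { apply Z.divide_trans with v; apply Z.gcd_divide_r. }
      assert (Hbc : (d * g | b * c)%Z).
      { apply Z.divide_abs_r. rewrite <- Zlcm_mul_gcd.
        destruct Hdl as [k1 ->].
        destruct (Z.gcd_greatest b c g gb gc) as [k2 ->].
        exists (k1 * k2)%Z; ring. }
      destruct (Z.gcd_bezout d b u eq_refl) as [s1 [t1 E1]].
      destruct (Z.gcd_bezout d c v eq_refl) as [s2 [t2 E2]].
      rewrite <- E1, <- E2.
      replace ((s1 * d + t1 * b) * (s2 * d + t2 * c))%Z with
        (s1 * s2 * (d * d) + s1 * t2 * (d * c) + t1 * s2 * (d * b) + t1 * t2 * (b * c))%Z by ring.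
      repeat apply Z.divide_add_r; apply Z.divide_mul_r;
        try apply Z.mul_divide_mono_l; assumption. }
    apply Z.divide_trans with (1 := H).
    apply Z.lcm_least.
    + apply Z.divide_trans with (Z.gcd a b); [|apply Z.divide_lcm_l].
      apply Z.gcd_greatest; [|apply Z.gcd_divide_r].
      apply Z.divide_trans with d; [apply Z.gcd_divide_l|exact Hda].
    + apply Z.divide_trans with (Z.gcd a c); [|apply Z.divide_lcm_r].
      apply Z.gcd_greatest; [|apply Z.gcd_divide_r].
      apply Z.divide_trans with d; [apply Z.gcd_divide_l|exact Hda].
  - apply Z.lcm_least; apply Z.gcd_greatest.
    + apply Z.gcd_divide_l.
    + apply Z.divide_trans with b; [apply Z.gcd_divide_r|apply Z.divide_lcm_l].
    + apply Z.gcd_divide_l.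
    + apply Z.divide_trans with c; [apply Z.gcd_divide_r|apply Z.divide_lcm_r].
Qed.

Definition strongly_divisible (w : nat -> Z) : Prop :=
  (forall n, (0 <= w n)%Z) /\
  forall c m n, Nat.Odd m -> Nat.Odd n -> Nat.gcd m n = 1%nat ->
    Z.gcd (w (c * m)%nat) (w (c * n)%nat) = w c.

Lemma Zgcd_add_unit (u v g e : Z) : (e = 1 \/ e = -1)%Z ->
  Z.gcd u (v * u + e * g) = Z.gcd u g.
Proof.
  intros He. rewrite Z.add_comm, Z.gcd_add_mult_diag_r.
  destruct He as [-> | ->]; [now rewrite Z.mul_1_l|].
  replace (-1 * g)%Z with (- g)%Z by ring. apply Z.gcd_opp_r.
Qed.

(* Euclid's algorithm with even quotients: (m, n) is replaced by (m, |n - 2m|),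
   so that both entries stay odd and never reach 0. *)
Lemma Zgcd_odd_multiples (W : nat -> Z) :
  (forall i j, exists v e, (e = 1 \/ e = -1)%Z /\ (W (2 * i + j)%nat = v * W i + e * W j)%Z) ->
  (forall i j, exists v e, (e = 1 \/ e = -1)%Z /\
     (W (2 * i + j)%nat = v * W (i + j)%nat + e * W j)%Z) ->
  forall c s m n, (m + n <= s)%nat -> Nat.Odd m -> Nat.Odd n ->
    Z.gcd (W (c * m)%nat) (W (c * n)%nat) = Z.abs (W (c * Nat.gcd m n)%nat).
Proof.
  intros H1 H2 c s.
  induction s as [|s IH]; intros m n Hs Hm Hn.
  { destruct Hm. lia. }
  assert (Hlt : forall m n, (m + n <= S s)%nat -> Nat.Odd m -> Nat.Odd n -> (m < n)%nat ->
    Z.gcd (W (c * m)%nat) (W (c * n)%nat) = Z.abs (W (c * Nat.gcd m n)%nat)).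
  { clear m n Hs Hm Hn. intros m n Hs [m' Hm] [n' Hn] Hmn.
    (* If n < 2m, the new entry is 2m - n, and the second identity is used with indices c(n - m) and
       c(2m - n), whose sum is cm. Otherwise the first identity is used with cm and c(n - 2m). *)
    destruct (Nat.lt_ge_cases n (2 * m)) as [H|H].
    - destruct (H2 (c * (n - m))%nat (c * (2 * m - n))%nat) as (v & e & He & E).
      replace (2 * (c * (n - m)) + c * (2 * m - n))%nat with (c * n)%nat in E by nia.
      replace (c * (n - m) + c * (2 * m - n))%nat with (c * m)%nat in E by nia.
      rewrite E, Zgcd_add_unit by exact He.
      rewrite IH; [|lia|exists m'; lia|exists (2 * m' - n')%nat; lia].
      do 3 f_equal.
      set (i := (n - m)%nat). set (j := (2 * m - n)%nat).
      replace m with (j + 1 * i)%nat by lia.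
      replace n with (i + 1 * (j + 1 * i))%nat by lia.
      rewrite Nat.gcd_add_mult_diag_r, !(Nat.gcd_comm (j + 1 * i)), Nat.gcd_add_mult_diag_r.
      replace (j + 1 * i)%nat with (i + 1 * j)%nat by lia.
      rewrite Nat.gcd_add_mult_diag_r. apply Nat.gcd_comm.
    - destruct (H1 (c * m)%nat (c * (n - 2 * m))%nat) as (v & e & He & E).
      replace (2 * (c * m) + c * (n - 2 * m))%nat with (c * n)%nat in E by nia.
      rewrite E, Zgcd_add_unit by exact He.
      rewrite IH; [|lia|exists m'; lia|exists (n' - 2 * m' - 1)%nat; lia].
      do 3 f_equal.
      replace n with ((n - 2 * m) + 2 * m)%nat at 2 by lia.
      now rewrite Nat.gcd_add_mult_diag_r. }
  destruct (Nat.lt_trichotomy m n) as [H|[<-|H]].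
  - now apply Hlt.
  - rewrite Z.gcd_diag, Nat.gcd_diag. reflexivity.
  - rewrite Z.gcd_comm, Nat.gcd_comm. apply Hlt; auto; lia.
Qed.

Lemma strongly_divisible_abs (W : nat -> Z) :
  (forall i j, exists v e, (e = 1 \/ e = -1)%Z /\ (W (2 * i + j)%nat = v * W i + e * W j)%Z) ->
  (forall i j, exists v e, (e = 1 \/ e = -1)%Z /\
     (W (2 * i + j)%nat = v * W (i + j)%nat + e * W j)%Z) ->
  strongly_divisible (fun n => Z.abs (W n)).
Proof.
  intros H1 H2. split; [intros; apply Z.abs_nonneg|].
  intros c m n Hm Hn Hmn.
  rewrite Z.gcd_abs_l, Z.gcd_abs_r, (Zgcd_odd_multiples W H1 H2 c (m + n)) by auto.
  now rewrite Hmn, Nat.mul_1_r.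
Qed.

(* [fermat_prod j] is F_0 F_1 ... F_(j-1) = F_j - 2 for the Fermat numbers F_i = 2^(2^i) + 1. *)
Fixpoint fermat_prod (j : nat) : nat :=
  match j with
  | O => 1
  | S j => fermat_prod j * (fermat_prod j + 2)
  end.

(* The lcm of the w (c * fermat_prod j / F_i) for i < j. *)
Fixpoint fermat_lcm (w : nat -> Z) (j c : nat) : Z :=
  match j with
  | O => 1
  | S j => Z.lcm (w (c * fermat_prod j)%nat) (fermat_lcm w j (c * (fermat_prod j + 2)))
  end.

Lemma fermat_prod_odd (j : nat) : Nat.Odd (fermat_prod j).
Proof.
  induction j as [|j [i IH]]; [now exists 0%nat|].
  simpl. rewrite IH. exists (2 * i * i + 4 * i + 1)%nat. nia.
Qed.

(** Goldbach's coprimality of F_j to the earlier Fermat numbers: both entries are odd and they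
    differ by 2. *)
Lemma gcd_fermat_prod (j : nat) : Nat.gcd (fermat_prod j + 2) (fermat_prod j) = 1%nat.
Proof.
  destruct (fermat_prod_odd j) as [i ->].
  replace (2 * i + 1 + 2)%nat with (2 + 1 * (2 * i + 1))%nat by lia.
  rewrite Nat.gcd_comm, Nat.gcd_add_mult_diag_r, Nat.gcd_comm.
  replace (2 * i + 1)%nat with (1 + i * 2)%nat by lia.
  now rewrite Nat.gcd_add_mult_diag_r.
Qed.

Lemma coprime_mul_inv (m u v : nat) :
  Nat.gcd m (u * v) = 1%nat -> Nat.gcd m u = 1%nat /\ Nat.gcd m v = 1%nat.
Proof.
  assert (H : forall u v, Nat.gcd m (u * v) = 1%nat -> Nat.gcd m u = 1%nat).
  { intros u' v' E. apply Nat.divide_1_r. rewrite <- E. apply Nat.gcd_greatest.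
    - apply Nat.gcd_divide_l.
    - apply Nat.divide_mul_l, Nat.gcd_divide_r. }
  intros E. split; [now apply H with v|]. apply H with u. now rewrite Nat.mul_comm.
Qed.

Lemma coprime_mul_r (m u v : nat) :
  Nat.gcd m u = 1%nat -> Nat.gcd m v = 1%nat -> Nat.gcd m (u * v) = 1%nat.
Proof.
  intros Hu Hv. apply Nat.divide_1_r. rewrite <- Hv. apply Nat.gcd_greatest.
  - apply Nat.gcd_divide_l.
  - apply Nat.gauss with u; [apply Nat.gcd_divide_r|].
    apply Nat.divide_1_r. rewrite <- Hu. apply Nat.gcd_greatest.
    + eapply Nat.divide_trans; [apply Nat.gcd_divide_l|apply Nat.gcd_divide_l].
    + apply Nat.gcd_divide_r.
Qed.

Lemma fermat_lcm_nonneg (w : nat -> Z) (j c : nat) : (0 <= fermat_lcm w j c)%Z.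
Proof. destruct j; simpl; [lia|apply Z.lcm_nonneg]. Qed.

(** The gcd distributes over the lcm, and in each term strong divisibility strips the factor [m],
    which is coprime to the other cofactor. The parameter [t] collects the Fermat numbers split off
    by the recursion. *)
Lemma gcd_fermat_lcm (w : nat -> Z) : strongly_divisible w ->
  forall j c t m, Nat.Odd t -> Nat.Odd m -> Nat.gcd m (fermat_prod j * t) = 1%nat ->
    Z.gcd (w (c * (fermat_prod j * t))%nat) (fermat_lcm w j (c * m)) = fermat_lcm w j c.
Proof.
  intros [Hw0 Hw] j. induction j as [|j IH]; intros c t m Ht Hm Hg.
  { simpl. apply Z.gcd_1_r. }
  cbn [fermat_lcm fermat_prod] in *.
  set (P := fermat_prod j) in *.
  assert (HP : Nat.Odd P) by apply fermat_prod_odd.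
  assert (HP2 : Nat.Odd (P + 2)) by (destruct HP as [i ->]; exists (i + 1)%nat; lia).
  apply coprime_mul_inv in Hg as [Hg Hgt]. apply coprime_mul_inv in Hg as [HgP HgP2].
  rewrite Zgcd_lcm_distr. f_equal.
  - replace (c * (P * (P + 2) * t))%nat with (c * P * ((P + 2) * t))%nat by ring.
    replace (c * m * P)%nat with (c * P * m)%nat by ring.
    apply Hw; [now apply Nat.Odd_mul|exact Hm|].
    rewrite Nat.gcd_comm. now apply coprime_mul_r.
  (* The induction hypothesis is used with [c * (P + 2)] for [c] and the same [t]; here P is its
     Fermat product. *)
  - replace (c * (P * (P + 2) * t))%nat with (c * (P + 2) * (P * t))%nat by ring.
    replace (c * m * (P + 2))%nat with (c * (P + 2) * m)%nat by ring.
    apply IH; auto. now apply coprime_mul_r.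
Qed.

(** This is lcm times gcd equals product, the gcd being known from [gcd_fermat_lcm] with t = 1 and m
    = F_j. It makes the recursion multiplicative, so that sizes can be computed. *)
Lemma fermat_lcm_step (w : nat -> Z) (j c : nat) : strongly_divisible w ->
  (fermat_lcm w (S j) c * fermat_lcm w j c =
   w (c * fermat_prod j)%nat * fermat_lcm w j (c * (fermat_prod j + 2)))%Z.
Proof.
  intros Hw. cbn [fermat_lcm].
  rewrite <- (gcd_fermat_lcm w Hw j c 1 (fermat_prod j + 2)).
  - rewrite Nat.mul_1_r, Zlcm_mul_gcd. apply Z.abs_eq.
    apply Z.mul_nonneg_nonneg; [apply Hw|apply fermat_lcm_nonneg].
  - now exists 0%nat.
  - destruct (fermat_prod_odd j) as [i ->]. exists (i + 1)%nat; lia.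
  - rewrite Nat.mul_1_r. apply gcd_fermat_prod.
Qed.

Lemma fermat_lcm_divide (w : nat -> Z) (j c : nat) : strongly_divisible w ->
  (fermat_lcm w j c | w (c * fermat_prod j)%nat)%Z.
Proof.
  intros Hw. revert c. induction j as [|j IH]; intros c; [apply Z.divide_1_l|].
  cbn [fermat_lcm fermat_prod].
  set (P := fermat_prod j) in *.
  apply Z.lcm_least.
  - destruct Hw as [_ Hw].
    rewrite <- (Hw (c * P)%nat 1%nat (P + 2)%nat).
    + rewrite Nat.mul_assoc. apply Z.gcd_divide_r.
    + now exists 0%nat.
    + destruct (fermat_prod_odd j) as [i Hi]. exists (i + 1)%nat. fold P in Hi. lia.
    + reflexivity.
  - replace (c * (P * (P + 2)))%nat with (c * (P + 2) * P)%nat by ring. apply IH.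
Qed.

(** The index starts at 1 because U_0 = 0. *)
Definition growth (h K : R) (w : nat -> Z) : Prop :=
  1 <= K /\ forall n, (1 <= n)%nat -> h ^ n <= K * IZR (w n) /\ IZR (w n) <= K * h ^ n.

(** With L = [fermat_prod j], the lcm has order h^(c(L - 1)/2), just below the square root of
    h^(cL). The exponent follows from [fermat_lcm_step]. *)
Lemma fermat_lcm_growth (w : nat -> Z) (h K : R) (j : nat) :
  0 < h -> strongly_divisible w -> growth h K w ->
  exists (e : nat) (K' : R), (2 * e + 1 = fermat_prod j)%nat /\ 1 <= K' /\
    forall c, (1 <= c)%nat ->
      h ^ (c * e) <= K' * IZR (fermat_lcm w j c) /\
      IZR (fermat_lcm w j c) <= K' * h ^ (c * e).
Proof.
  intros Hh Hw [HK Hg]. induction j as [|j (e & K' & He & HK' & IH)].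
  { exists 0%nat, 1. simpl. repeat split; try lra; rewrite Nat.mul_0_r; simpl; lra. }
  (* The step identity gives the exponent P + (P + 2)e - e, and each of its three known quantities
     contributes one constant. *)
  exists (fermat_prod j + (fermat_prod j + 1) * e)%nat, (K * K' * K').
  split; [simpl; nia|]. split.
  { assert (1 <= K * K') by nra. nra. }
  intros c Hc.
  pose proof (fermat_lcm_step w j c Hw) as E. apply (f_equal IZR) in E. rewrite !mult_IZR in E.
  set (P := fermat_prod j) in *.
  assert (HP : (1 <= P)%nat) by lia.
  destruct (IH c Hc) as [L1 U1].
  destruct (IH (c * (P + 2))%nat ltac:(nia)) as [L2 U2].
  destruct (Hg (c * P)%nat ltac:(nia)) as [L3 U3].
  set (B0 := IZR (fermat_lcm w j c)) in *.
  set (B1 := IZR (fermat_lcm w (S j) c)) in *.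
  set (B2 := IZR (fermat_lcm w j (c * (P + 2)))) in *.
  set (w0 := IZR (w (c * P)%nat)) in *.
  replace (h ^ (c * (P + (P + 1) * e))) with (h ^ (c * P) * h ^ (c * (P + 2) * e) / h ^ (c * e)).
  2:{ replace (c * (P + 2) * e)%nat with (c * e + c * (P + 1) * e)%nat by ring.
      replace (c * (P + (P + 1) * e))%nat with (c * P + c * (P + 1) * e)%nat by ring.
      rewrite !pow_add. field. apply pow_nonzero; lra. }
  assert (p1 : 0 < h ^ (c * e)) by now apply pow_lt.
  assert (p2 : 0 < h ^ (c * (P + 2) * e)) by now apply pow_lt.
  assert (p3 : 0 < h ^ (c * P)) by now apply pow_lt.
  set (x1 := h ^ (c * e)) in *. set (x2 := h ^ (c * (P + 2) * e)) in *.
  set (x3 := h ^ (c * P)) in *.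
  assert (b0 : 0 < B0) by nra. assert (b2 : 0 < B2) by nra. assert (b3 : 0 < w0) by nra.
  assert (E' : B1 = w0 * B2 / B0) by (rewrite <- E; field; lra).
  rewrite E'. split.
  - apply Rmult_le_reg_r with (x1 * B0); [nra|].
    replace (x3 * x2 / x1 * (x1 * B0)) with (x3 * x2 * B0) by (field; lra).
    replace (K * K' * K' * (w0 * B2 / B0) * (x1 * B0)) with ((K * w0) * (K' * B2) * (K' * x1))
      by (field; lra).
    apply Rmult_le_compat; try nra.
  - apply Rmult_le_reg_r with (x1 * B0); [nra|].
    replace (w0 * B2 / B0 * (x1 * B0)) with (w0 * B2 * x1) by (field; lra).
    replace (K * K' * K' * (x3 * x2 / x1) * (x1 * B0)) with ((K * x3) * (K' * x2) * (K' * B0))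
      by (field; lra).
    apply Rmult_le_compat; try nra.
Qed.

(** Here [z] is the lcm and [y] its cofactor. The last inequality lets a fixed integer multiple of
    [y] exceed [z]. *)
Lemma balanced_factorization (w : nat -> Z) (h K : R) (j : nat) :
  1 <= h -> strongly_divisible w -> growth h K w ->
  exists (e : nat) (K' : R), (2 * e + 1 = fermat_prod j)%nat /\ 1 <= K' /\
    forall k, (1 <= k)%nat -> exists y z : Z, (0 < y)%Z /\ (0 < z)%Z /\
      (y * z = w (k * fermat_prod j)%nat)%Z /\
      IZR y <= K' * h ^ (k * (e + 1)) /\ IZR z <= K' * h ^ (k * e) /\
      IZR z <= K' * IZR y.
Proof.
  intros Hh Hw Hg.
  destruct (fermat_lcm_growth w h K j ltac:(lra) Hw Hg) as (e & K' & He & HK' & H).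
  destruct Hg as [HK Hg].
  exists e, (K * K' * K'). 
  assert (HKK : 1 <= K * K') by nra.
  split; [exact He|]. split; [nra|].
  intros k Hk.
  destruct (fermat_lcm_divide w j k Hw) as [y Hy].
  set (z := fermat_lcm w j k) in *.
  destruct (H k Hk) as [L1 U1]. fold z in L1, U1.
  destruct (Hg (k * fermat_prod j)%nat ltac:(nia)) as [L2 U2].
  rewrite Hy, mult_IZR in L2, U2.
  replace (h ^ (k * fermat_prod j)) with (h ^ (k * (e + 1)) * h ^ (k * e)) in L2, U2.
  2:{ rewrite <- pow_add. f_equal. nia. }
  assert (p1 : 1 <= h ^ (k * e)) by now apply pow_R1_Rle.
  assert (p2 : h ^ (k * e) <= h ^ (k * (e + 1))) by (apply Rle_pow; [exact Hh|nia]).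
  set (x1 := h ^ (k * e)) in *. set (x2 := h ^ (k * (e + 1))) in *.
  assert (z0 : 0 < IZR z) by nra.
  assert (Hyz : 0 < IZR y * IZR z) by nra.
  assert (y0 : 0 < IZR y) by nra.
  assert (Hy2 : IZR y <= K * K' * x2).
  { apply Rmult_le_reg_r with (IZR z); [exact z0|].
    apply Rle_trans with (1 := U2).
    replace (K * (x2 * x1)) with (K * x2 * x1) by ring.
    replace (K * K' * x2 * IZR z) with (K * x2 * (K' * IZR z)) by ring.
    apply Rmult_le_compat_l; nra. }
  assert (Hx2 : x2 <= K * K' * IZR y).
  { apply Rmult_le_reg_r with x1; [lra|].
    apply Rle_trans with (1 := L2).
    replace (K * K' * IZR y * x1) with (K * IZR y * (K' * x1)) by ring.
    replace (K * (IZR y * IZR z)) with (K * IZR y * IZR z) by ring.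
    apply Rmult_le_compat_l; nra. }
  assert (K' * x1 <= K * K' * K' * x1).
  { apply Rmult_le_compat_r; [lra|]. nra. }
  assert (K * K' * x2 <= K * K' * K' * x2).
  { apply Rmult_le_compat_r; [lra|]. nra. }
  exists y, z. split; [now apply lt_IZR|]. split; [now apply lt_IZR|].
  split; [now symmetry|]. split; [lra|]. split; [lra|].
  apply Rle_trans with (K' * x2); [nra|].
  replace (K * K' * K' * IZR y) with (K' * (K * K' * IZR y)) by ring.
  apply Rmult_le_compat_l; lra.
Qed.

(** * Gaps between consecutive values *)

Definition energy (alpha : R) (p : nat * nat) : R :=
  alpha * INR (fst p) ^ 2 + INR (snd p) ^ 2.

(** Convertible to the list whose length is [count_below], which justifies the later uses of
    [change]. *)
Definition pairs_below (alpha t : R) : list (nat * nat) :=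
  filter (fun p => if Rlt_dec (energy alpha p) t then true else false)
    (list_prod (seq 1 (bnd alpha t)) (seq 1 (bnd alpha t))).

Lemma le_up_sqrt (n : nat) (y : R) : INR n ^ 2 <= y -> (n <= Z.to_nat (up (sqrt y)))%nat.
Proof.
  intros H.
  assert (INR n <= sqrt y).
  { rewrite <- (sqrt_pow2 (INR n)) by apply pos_INR. now apply sqrt_le_1_alt. }
  destruct (archimed (sqrt y)) as [Hu _].
  assert (Hz : (Z.of_nat n < up (sqrt y))%Z).
  { apply lt_IZR. rewrite <- INR_IZR_INZ. lra. }
  lia.
Qed.

(** The box of side [bnd] loses no pair, since alpha m^2 and n^2 are each below [t]. *)
Lemma in_pairs_below (alpha t : R) (p : nat * nat) : 0 < alpha ->
  In p (pairs_below alpha t) <->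
  (1 <= fst p)%nat /\ (1 <= snd p)%nat /\ energy alpha p < t.
Proof.
  intros Ha. destruct p as [m n]. unfold pairs_below.
  rewrite filter_In, in_prod_iff, !in_seq. cbn [fst snd].
  destruct (Rlt_dec (energy alpha (m, n)) t) as [Hlt|Hlt].
  - split; [intros [[[? ?] [? ?]] _]; auto|]. intros (Hm & Hn & _).
    unfold energy in Hlt; cbn [fst snd] in Hlt.
    assert (0 <= INR m ^ 2) by apply pow2_ge_0.
    assert (0 <= INR n ^ 2) by apply pow2_ge_0.
    assert (m <= Z.to_nat (up (sqrt (t / alpha))))%nat.
    { apply le_up_sqrt. apply Rmult_le_reg_l with alpha; [exact Ha|].
      replace (alpha * (t / alpha)) with t by (field; lra). lra. }
    assert (n <= Z.to_nat (up (sqrt t)))%nat by (apply le_up_sqrt; nra).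
    unfold bnd. lia.
  - split; [intros [_ H]; discriminate|tauto].
Qed.

Lemma NoDup_list_prod {A B : Type} (l : list A) (l' : list B) :
  NoDup l -> NoDup l' -> NoDup (list_prod l l').
Proof.
  intros Hl Hl'. induction Hl as [|y l Hy Hl IH]; [constructor|].
  simpl. apply NoDup_app; [|exact IH|].
  - apply NoDup_map_NoDup_ForallPairs; [|exact Hl'].
    intros u v _ _ E; now inversion E.
  - intros [u v] H1 H2. apply in_map_iff in H1. destruct H1 as [z [E _]].
    inversion E; subst. apply in_prod_iff in H2. tauto.
Qed.

Lemma NoDup_pairs_below (alpha t : R) : NoDup (pairs_below alpha t).
Proof.
  apply NoDup_filter, NoDup_list_prod; apply seq_NoDup.
Qed.

Lemma count_below_le (alpha t : R) : (count_below alpha t <= bnd alpha t * bnd alpha t)%nat.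
Proof.
  change (length (pairs_below alpha t) <= bnd alpha t * bnd alpha t)%nat.
  unfold pairs_below. etransitivity; [apply filter_length_le|].
  rewrite length_prod, length_seq. lia.
Qed.

Lemma count_below_lt (alpha t t' : R) : 0 < alpha -> is_value alpha t -> t < t' ->
  (count_below alpha t < count_below alpha t')%nat.
Proof.
  intros Ha (m & n & Hm & Hn & Et) Htt.
  change (S (length (pairs_below alpha t)) <= length (pairs_below alpha t'))%nat.
  change (length ((m, n) :: pairs_below alpha t) <= length (pairs_below alpha t'))%nat.
  apply NoDup_incl_length.
  - constructor; [|apply NoDup_pairs_below].
    rewrite in_pairs_below by exact Ha. unfold energy; cbn [fst snd]. rewrite <- Et. lra.
  - intros p [<-|Hp]; apply in_pairs_below; try exact Ha.
    + unfold energy; cbn [fst snd]. rewrite <- Et. auto.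
    + apply in_pairs_below in Hp; [|exact Ha]. intuition lra.
Qed.

(** The value [t] itself witnesses the choice operator, and strict growth of the count on values
    makes the witness unique. *)
Lemma lambda_count (alpha t : R) : 0 < alpha -> is_value alpha t ->
  lambda alpha (count_below alpha t + 1) = t.
Proof.
  intros Ha Ht.
  assert (H : is_lambda alpha (count_below alpha t + 1) (lambda alpha (count_below alpha t + 1))).
  { unfold lambda. apply epsilon_spec. exists t. split; auto. }
  destruct H as [Hv Hc].
  destruct (Rtotal_order (lambda alpha (count_below alpha t + 1)) t) as [H|[H|H]]; auto.
  - apply (count_below_lt alpha) in H; auto. lia.
  - apply (count_below_lt alpha) in H; auto. lia.
Qed.

(** A coincidence with m <> m' would give alpha = (n'^2 - n^2)/(m^2 - m'^2), a rational number. *)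
Lemma energy_inj (alpha : R) (p p' : nat * nat) : (forall q : Q, alpha <> Q2R q) ->
  energy alpha p = energy alpha p' -> p = p'.
Proof.
  intros Hirr. destruct p as [m n], p' as [m' n']. unfold energy; cbn [fst snd].
  intros E.
  assert (sq : forall i j : nat, INR i ^ 2 = INR j ^ 2 -> i = j).
  { intros i j H. apply INR_eq.
    assert (0 <= INR i) by apply pos_INR. assert (0 <= INR j) by apply pos_INR. nra. }
  destruct (Nat.eq_dec m m') as [<-|Hne].
  { f_equal. apply sq. lra. }
  exfalso.
  assert (Hd : INR m ^ 2 - INR m' ^ 2 <> 0).
  { intros H. apply Hne, sq. lra. }
  assert (Ea : alpha = (INR n' ^ 2 - INR n ^ 2) / (INR m ^ 2 - INR m' ^ 2)).
  { apply Rmult_eq_reg_r with (INR m ^ 2 - INR m' ^ 2); [|exact Hd].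
    unfold Rdiv. rewrite Rmult_assoc, Rinv_l by exact Hd. lra. }
  set (za := (Z.of_nat n' ^ 2 - Z.of_nat n ^ 2)%Z).
  set (zb := (Z.of_nat m ^ 2 - Z.of_nat m' ^ 2)%Z).
  assert (Eza : IZR za = INR n' ^ 2 - INR n ^ 2).
  { unfold za. rewrite minus_IZR, !INR_IZR_INZ, !pow_IZR. reflexivity. }
  assert (Ezb : IZR zb = INR m ^ 2 - INR m' ^ 2).
  { unfold zb. rewrite minus_IZR, !INR_IZR_INZ, !pow_IZR. reflexivity. }
  rewrite <- Eza, <- Ezb in Ea. rewrite <- Ezb in Hd.
  assert (zb <> 0%Z) by (intros H; apply Hd; now rewrite H).
  apply (Hirr (inject_Z za / inject_Z zb)%Q).
  rewrite Q2R_div.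
  - unfold Q2R at 1 2; simpl. rewrite Ea. field. exact Hd.
  - intros H'. apply H. unfold Qeq in H'; simpl in H'. lia.
Qed.

Lemma argmin_list {A : Type} (f : A -> R) (l : list A) : l <> nil ->
  exists y, In y l /\ forall z, In z l -> f y <= f z.
Proof.
  induction l as [|y l IH]; [tauto|]. intros _.
  destruct l as [|y' l'].
  - exists y. split; [now left|]. intros z [->|[]]; lra.
  - destruct IH as [z [Hz Hmin]]; [discriminate|].
    destruct (Rle_dec (f y) (f z)) as [H|H].
    + exists y. split; [now left|]. intros w [->|Hw]; [lra|].
      specialize (Hmin w Hw). lra.
    + exists z. split; [now right|]. intros w [->|Hw]; [lra|auto].
Qed.

(** The successor of [t] in the list of values is the least value above [t], hence at most [t']. *)
Lemma gap_count_le (alpha t t' : R) : 0 < alpha -> (forall q : Q, alpha <> Q2R q) ->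
  is_value alpha t -> is_value alpha t' -> t < t' ->
  gap alpha (count_below alpha t + 1) <= t' - t.
Proof.
  intros Ha Hirr Ht Ht' Htt.
  destruct Ht as (m & n & Hm & Hn & Et). destruct Ht' as (m' & n' & Hm' & Hn' & Et').
  (* The bound [t' + 1] keeps the search finite and still admits [t'], since [pairs_below] is
     strict. *)
  set (above := filter (fun p => if Rlt_dec t (energy alpha p) then true else false)
                  (pairs_below alpha (t' + 1))).
  assert (Habove : forall p, In p above <->
     ((1 <= fst p)%nat /\ (1 <= snd p)%nat /\ energy alpha p < t' + 1) /\ t < energy alpha p).
  { intros p. unfold above. rewrite filter_In, in_pairs_below by exact Ha.
    destruct (Rlt_dec t (energy alpha p)); intuition discriminate. }
  assert (H' : In (m', n') above).
  { apply Habove. unfold energy; cbn [fst snd]. rewrite <- Et'.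
    repeat split; auto; lra. }
  destruct (argmin_list (energy alpha) above) as [p [Hp Hmin]].
  { intros E. rewrite E in H'. exact H'. }
  pose proof (Hmin _ H') as Hpt'. unfold energy in Hpt' at 2; cbn [fst snd] in Hpt'.
  rewrite <- Et' in Hpt'.
  apply Habove in Hp. destruct Hp as [[Hp1 [Hp2 Hp3]] Hp4].
  assert (Hval : is_value alpha (energy alpha p)) by (exists (fst p), (snd p); auto).
  assert (Hvt : is_value alpha t) by (exists m, n; auto).
  (* Below the minimizer lie only the pairs below [t] and, by injectivity, the single pair of value
     [t]. *)
  assert (Hc : count_below alpha (energy alpha p) = S (count_below alpha t)).
  { apply Nat.le_antisymm; [|apply count_below_lt; auto].
    change (length (pairs_below alpha (energy alpha p)) <= length ((m, n) :: pairs_below alpha t))%nat.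
    apply NoDup_incl_length; [apply NoDup_pairs_below|].
    intros q Hq. apply in_pairs_below in Hq; [|exact Ha]. destruct Hq as (Hq1 & Hq2 & Hq3).
    destruct (Rtotal_order (energy alpha q) t) as [H|[H|H]].
    - right. apply in_pairs_below; auto.
    - left. apply (energy_inj alpha); [exact Hirr|]. rewrite H, Et. reflexivity.
    - exfalso. assert (Hin : In q above) by (apply Habove; repeat split; auto; lra).
      apply Hmin in Hin. lra. }
  unfold gap.
  replace (S (count_below alpha t + 1)) with (count_below alpha (energy alpha p) + 1)%nat by lia.
  rewrite !lambda_count by auto. lra.
Qed.

Lemma fold_left_Rmin_le (l : list R) (y : R) :
  fold_left Rmin l y <= y /\ forall z, In z l -> fold_left Rmin l y <= z.
Proof.
  revert y. induction l as [|w l IH]; intros y; simpl.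
  - split; [lra|tauto].
  - destruct (IH (Rmin y w)) as [H1 H2].
    pose proof (Rmin_l y w). pose proof (Rmin_r y w).
    split; [lra|]. intros z [<-|Hz]; [lra|auto].
Qed.

Lemma delta_min_le_gap (alpha : R) (N i : nat) : (1 <= i < N)%nat ->
  delta_min alpha N <= gap alpha i.
Proof.
  intros Hi. unfold delta_min.
  destruct (fold_left_Rmin_le (map (gap alpha) (seq 2 (N - 2))) (gap alpha 1)) as [H1 H2].
  destruct (Nat.eq_dec i 1) as [->|Hne]; [exact H1|].
  apply H2, in_map, in_seq. lia.
Qed.

(** The index of [t] is at most the count below [t'], which is at most the area of the box. This
    crude count loses only a constant factor. *)
Lemma delta_min_le (alpha t t' : R) (N : nat) : 0 < alpha -> (forall q : Q, alpha <> Q2R q) ->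
  is_value alpha t -> is_value alpha t' -> t < t' ->
  (bnd alpha t' * bnd alpha t' < N)%nat -> delta_min alpha N <= t' - t.
Proof.
  intros Ha Hirr Ht Ht' Htt HN.
  eapply Rle_trans; [|apply gap_count_le; eauto].
  apply delta_min_le_gap.
  pose proof (count_below_lt alpha t t' Ha Ht Htt). pose proof (count_below_le alpha t'). lia.
Qed.

Lemma INR_bnd_le (alpha t : R) : 0 < alpha ->
  INR (bnd alpha t) <= sqrt (t / alpha) + sqrt t + 2.
Proof.
  intros Ha. unfold bnd. rewrite plus_INR.
  assert (H : forall y, INR (Z.to_nat (up (sqrt y))) <= sqrt y + 1).
  { intros y. destruct (archimed (sqrt y)) as [H1 H2]. pose proof (sqrt_pos y).
    assert (0 < up (sqrt y))%Z by (apply lt_IZR; lra).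
    rewrite INR_IZR_INZ, Z2Nat.id by lia. lra. }
  pose proof (H (t / alpha)). pose proof (H t). lra.
Qed.

(** * Lucas sequences *)

(** The recurrence w_(n+2) = x w_(n+1) + sigma w_n, run on a pair of consecutive terms. Arbitrary
    initial values let the closed form be proved by induction. *)
Fixpoint lucas (x sigma p q : Z) (n : nat) : Z :=
  match n with
  | O => p
  | S n => lucas x sigma q (x * q + sigma * p) n
  end.

Definition lucasU (x sigma : Z) : nat -> Z := lucas x sigma 0 1.
Definition lucasV (x sigma : Z) : nat -> Z := lucas x sigma 2 x.

Lemma lucas_closed (x sigma : Z) (h h' : R) (n : nat) (p q : Z) :
  h + h' = IZR x -> h * h' = IZR (- sigma) ->
  (h - h') * IZR (lucas x sigma p q n) =
  (IZR q - IZR p * h') * h ^ n - (IZR q - IZR p * h) * h' ^ n.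
Proof.
  intros Hx Hs. rewrite opp_IZR in Hs. revert p q.
  induction n as [|n IH]; intros p q; simpl; [ring|].
  rewrite IH, plus_IZR, !mult_IZR, <- Hx.
  replace (IZR sigma) with (- (h * h')) by lra. ring.
Qed.

Lemma lucasU_closed (x sigma : Z) (h h' : R) (n : nat) :
  h + h' = IZR x -> h * h' = IZR (- sigma) ->
  (h - h') * IZR (lucasU x sigma n) = h ^ n - h' ^ n.
Proof.
  intros Hx Hs. unfold lucasU. rewrite (lucas_closed x sigma h h') by auto. simpl; ring.
Qed.

Lemma lucasV_closed (x sigma : Z) (h h' : R) (n : nat) :
  h + h' = IZR x -> h * h' = IZR (- sigma) -> h - h' <> 0 ->
  IZR (lucasV x sigma n) = h ^ n + h' ^ n.
Proof.
  intros Hx Hs Hd. apply Rmult_eq_reg_l with (h - h'); [|exact Hd].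
  unfold lucasV. rewrite (lucas_closed x sigma h h'), <- Hx by auto. ring.
Qed.

Lemma lucasU_double (x sigma : Z) (h h' : R) (n : nat) :
  h + h' = IZR x -> h * h' = IZR (- sigma) -> h - h' <> 0 ->
  lucasU x sigma (2 * n) = (lucasU x sigma n * lucasV x sigma n)%Z.
Proof.
  intros Hx Hs Hd. apply eq_IZR. apply Rmult_eq_reg_l with (h - h'); [|exact Hd].
  rewrite mult_IZR, <- Rmult_assoc, !(lucasU_closed x sigma h h'), (lucasV_closed x sigma h h') by auto.
  replace (2 * n)%nat with (n + n)%nat by lia. rewrite !pow_add. ring.
Qed.

Lemma unit_pow (e : Z) (n : nat) : (e = 1 \/ e = -1)%Z -> (e ^ Z.of_nat n = 1 \/ e ^ Z.of_nat n = -1)%Z.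
Proof.
  intros He. induction n as [|n IH]; [now left|].
  rewrite Nat2Z.inj_succ, Z.pow_succ_r by lia. lia.
Qed.

(* [f = h - h', omega = 1] is the sequence U and [f = 1, omega = -1] is V. *)
Lemma lucas_strongly_divisible (x sigma omega : Z) (h h' f : R) (W : nat -> Z) :
  (sigma = 1 \/ sigma = -1)%Z -> (omega = 1 \/ omega = -1)%Z ->
  h + h' = IZR x -> h * h' = IZR (- sigma) -> h - h' <> 0 -> f <> 0 ->
  (forall n, f * IZR (W n) = h ^ n - IZR omega * h' ^ n) ->
  strongly_divisible (fun n => Z.abs (W n)).
Proof.
  intros Hsig Hom Hx Hs Hd Hf HW.
  assert (Hs1 : (- sigma = 1 \/ - sigma = -1)%Z) by lia.
  apply strongly_divisible_abs; intros i j.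
  (* Expanding V_(i+j) W_i leaves W_(2i+j) and cross terms with factor (h h')^i; as h h' = -sigma,
     the coefficient of W_j is a unit. *)
  - exists (lucasV x sigma (i + j)), (omega * (- sigma) ^ Z.of_nat i)%Z. split.
    { destruct (unit_pow (- sigma) i Hs1) as [-> | ->]; lia. }
    apply eq_IZR. apply Rmult_eq_reg_l with f; [|exact Hf].
    rewrite plus_IZR, !mult_IZR, <- pow_IZR, <- Hs, (lucasV_closed x sigma h h') by auto.
    match goal with |- _ = f * (?v * ?w + ?o * ?p * ?w') =>
      replace (f * (v * w + o * p * w')) with (v * (f * w) + o * p * (f * w')) by ring end.
    rewrite !HW, Rpow_mult_distr. replace (2 * i + j)%nat with (i + i + j)%nat by lia.
    rewrite !pow_add. destruct Hom as [-> | ->]; ring.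
  - exists (lucasV x sigma i), (- (- sigma) ^ Z.of_nat i)%Z. split.
    { destruct (unit_pow (- sigma) i Hs1) as [-> | ->]; lia. }
    apply eq_IZR. apply Rmult_eq_reg_l with f; [|exact Hf].
    rewrite plus_IZR, !mult_IZR, opp_IZR, <- pow_IZR, <- Hs, (lucasV_closed x sigma h h') by auto.
    match goal with |- _ = f * (?v * ?w + - ?p * ?w') =>
      replace (f * (v * w + - p * w')) with (v * (f * w) - p * (f * w')) by ring end.
    rewrite !HW, Rpow_mult_distr. replace (2 * i + j)%nat with (i + i + j)%nat by lia.
    rewrite !pow_add. ring.
Qed.

(** As h h' is 1 or -1, the absolute value of h'^n is exactly h^(-n). *)
Lemma conj_pow_bound (h h' : R) (e : Z) (n : nat) : 1 < h -> (e = 1 \/ e = -1)%Z ->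
  h * h' = IZR e -> - / h ^ n <= h' ^ n <= / h ^ n.
Proof.
  intros Hh He Hhh.
  assert (p : 0 < h ^ n) by (apply pow_lt; lra).
  assert (E : h' ^ n = IZR (e ^ Z.of_nat n) * / h ^ n).
  { rewrite <- pow_IZR, <- Hhh, Rpow_mult_distr. field. lra. }
  assert (0 < / h ^ n) by now apply Rinv_0_lt_compat.
  rewrite E. destruct (unit_pow e n He) as [-> | ->]; lra.
Qed.

(** For n >= 1 the conjugate term is at most 1 in absolute value, hence at most h^(n-1) = h^n /
    h. *)
Lemma lucas_bounds (h h' f : R) (e omega : Z) (W : nat -> Z) (n : nat) :
  1 < h -> (e = 1 \/ e = -1)%Z -> (omega = 1 \/ omega = -1)%Z -> h * h' = IZR e ->
  (forall n, f * IZR (W n) = h ^ n - IZR omega * h' ^ n) -> (1 <= n)%nat ->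
  (1 - / h) * h ^ n <= f * IZR (W n) <= 2 * h ^ n.
Proof.
  intros Hh He Hom Hhh HW Hn.
  rewrite HW. pose proof (conj_pow_bound h h' e n Hh He Hhh) as Hb.
  assert (H1 : 1 <= h ^ (n - 1)) by (apply pow_R1_Rle; lra).
  assert (H2 : h ^ n = h * h ^ (n - 1)).
  { change (h * h ^ (n - 1)) with (h ^ (S (n - 1))). f_equal. lia. }
  assert (H3 : / h * h ^ n = h ^ (n - 1)) by (rewrite H2; field; lra).
  assert (H4 : / h ^ n <= 1).
  { rewrite <- Rinv_1. apply Rinv_le_contravar; [lra|]. nra. }
  destruct Hom as [-> | ->]; nra.
Qed.

Lemma lucas_pos (h h' f : R) (e omega : Z) (W : nat -> Z) (n : nat) :
  1 < h -> (e = 1 \/ e = -1)%Z -> (omega = 1 \/ omega = -1)%Z -> h * h' = IZR e -> 0 < f ->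
  (forall n, f * IZR (W n) = h ^ n - IZR omega * h' ^ n) -> (1 <= n)%nat -> (0 < W n)%Z.
Proof.
  intros Hh He Hom Hhh Hf HW Hn. apply lt_IZR.
  pose proof (lucas_bounds h h' f e omega W n Hh He Hom Hhh HW Hn) as [Hb _].
  assert (0 < h ^ n) by (apply pow_lt; lra).
  assert (/ h < 1) by (rewrite <- Rinv_1; apply Rinv_lt_contravar; lra).
  nra.
Qed.

Lemma lucas_growth (h h' f : R) (e omega : Z) (W : nat -> Z) :
  1 < h -> (e = 1 \/ e = -1)%Z -> (omega = 1 \/ omega = -1)%Z -> h * h' = IZR e -> 0 < f ->
  (forall n, f * IZR (W n) = h ^ n - IZR omega * h' ^ n) ->
  exists K, growth h K (fun n => Z.abs (W n)).
Proof.
  intros Hh He Hom Hhh Hf HW.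
  assert (Hi : 0 < 1 - / h).
  { assert (/ h < 1) by (rewrite <- Rinv_1; apply Rinv_lt_contravar; lra). lra. }
  assert (Hq1 : 0 < f / (1 - / h)) by (apply Rdiv_lt_0_compat; lra).
  assert (Hq2 : 0 < 2 / f) by (apply Rdiv_lt_0_compat; lra).
  exists (1 + f / (1 - / h) + 2 / f). split; [lra|].
  intros n Hn.
  pose proof (lucas_pos h h' f e omega W n Hh He Hom Hhh Hf HW Hn) as Hp.
  rewrite Z.abs_eq by lia. apply IZR_lt in Hp.
  pose proof (lucas_bounds h h' f e omega W n Hh He Hom Hhh HW Hn) as [B1 B2].
  assert (p : 0 < h ^ n) by (apply pow_lt; lra).
  split.
  - apply Rle_trans with (f / (1 - / h) * IZR (W n)); [|nra].
    apply Rmult_le_reg_l with (1 - / h); [exact Hi|].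
    replace ((1 - / h) * (f / (1 - / h) * IZR (W n))) with (f * IZR (W n)) by (field; split; [|]; nra).
    exact B1.
  - apply Rle_trans with (2 / f * h ^ n); [|nra].
    apply Rmult_le_reg_l with f; [exact Hf|].
    replace (f * (2 / f * h ^ n)) with (2 * h ^ n) by (field; lra). exact B2.
Qed.

(** * Pairs of close values *)

Lemma IZR_ge_1 (z : Z) : (0 < z)%Z -> 1 <= IZR z.
Proof. intros H. apply IZR_le. lia. Qed.

Lemma is_value_IZR (alpha : R) (m n : Z) : (0 < m)%Z -> (0 < n)%Z ->
  is_value alpha (alpha * IZR m ^ 2 + IZR n ^ 2).
Proof.
  intros Hm Hn. exists (Z.to_nat m), (Z.to_nat n).
  split; [lia|]. split; [lia|]. rewrite !INR_IZR_INZ, !Z2Nat.id by lia. reflexivity.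
Qed.

(* (p1 + q1)^2 - (p1 - q1)^2 = 4 p1 q1, so a good rational approximation p2 q2 / (p1 q1)
   of alpha makes the two values close; the size condition uses q1 < p1 and q2 < p2. *)
Lemma close_values_of_products (alpha : R) (p1 q1 p2 q2 : Z) :
  0 < alpha -> (forall q : Q, alpha <> Q2R q) ->
  (0 < q1 < p1)%Z -> (0 < q2 < p2)%Z ->
  exists t t' : R, is_value alpha t /\ is_value alpha t' /\ t < t' /\
    t' <= 4 * alpha * IZR p1 ^ 2 + 4 * IZR p2 ^ 2 /\
    t' - t <= 4 * Rabs (alpha * (IZR p1 * IZR q1) - IZR p2 * IZR q2).
Proof.
  intros Ha Hirr H1 H2.
  set (t1 := alpha * IZR (p1 + q1) ^ 2 + IZR (p2 - q2) ^ 2).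
  set (t2 := alpha * IZR (p1 - q1) ^ 2 + IZR (p2 + q2) ^ 2).
  assert (V1 : is_value alpha t1) by (apply is_value_IZR; lia).
  assert (V2 : is_value alpha t2) by (apply is_value_IZR; lia).
  (* Distinct pairs have distinct values. Which value is larger depends on the unknown sign of the
     approximation error, whence the case split at the end. *)
  assert (Hne : t1 <> t2).
  { intros E.
    assert (X : (Z.to_nat (p1 + q1), Z.to_nat (p2 - q2)) = (Z.to_nat (p1 - q1), Z.to_nat (p2 + q2))).
    { apply (energy_inj alpha); [exact Hirr|]. unfold energy; cbn [fst snd].
      rewrite !INR_IZR_INZ, !Z2Nat.id by lia. exact E. }
    injection X. lia. }
  assert (Hdiff : t1 - t2 = 4 * (alpha * (IZR p1 * IZR q1) - IZR p2 * IZR q2)).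
  { unfold t1, t2. rewrite !plus_IZR, !minus_IZR. ring. }
  assert (Hq1 : 0 < IZR q1 < IZR p1) by (split; apply IZR_lt; lia).
  assert (Hq2 : 0 < IZR q2 < IZR p2) by (split; apply IZR_lt; lia).
  assert (S1 : t1 <= 4 * alpha * IZR p1 ^ 2 + 4 * IZR p2 ^ 2).
  { unfold t1. rewrite !plus_IZR, !minus_IZR.
    assert (alpha * (IZR p1 + IZR q1) ^ 2 <= alpha * (4 * IZR p1 ^ 2)) by (apply Rmult_le_compat_l; nra).
    nra. }
  assert (S2 : t2 <= 4 * alpha * IZR p1 ^ 2 + 4 * IZR p2 ^ 2).
  { unfold t2. rewrite !plus_IZR, !minus_IZR.
    assert (alpha * (IZR p1 - IZR q1) ^ 2 <= alpha * (4 * IZR p1 ^ 2)) by (apply Rmult_le_compat_l; nra).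
    nra. }
  pose proof (Rle_abs (alpha * (IZR p1 * IZR q1) - IZR p2 * IZR q2)).
  pose proof (Rle_abs (- (alpha * (IZR p1 * IZR q1) - IZR p2 * IZR q2))) as Hab.
  rewrite Rabs_Ropp in Hab.
  destruct (Rtotal_order t1 t2) as [H'|[H'|H']]; [|contradiction|].
  - exists t1, t2. repeat split; auto. lra.
  - exists t2, t1. repeat split; auto. lra.
Qed.

(** With n = k(2e+1), the values have size O(h^(n+k)) and differ by O(h^(-n)); the ratio of
    exponents is 1 - 1/(2(e+1)). *)
Definition close_pairs (alpha h : R) (e : nat) : Prop :=
  exists C1 C2 : R, 0 < C1 /\ 0 < C2 /\
    forall k0 : nat, exists (k : nat) (t t' : R), (k0 <= k)%nat /\ (1 <= k)%nat /\
      is_value alpha t /\ is_value alpha t' /\ t < t' /\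
      t' <= C1 * h ^ (2 * (k * (e + 1))) /\ t' - t <= C2 / h ^ (k * (2 * e + 1)).

(* With n = k (2e+1), k = a mod 2 and n + a = 2m, one has v alpha W_n = u T U_2m + O(h^-n);
   W_n = y z splits by [balanced_factorization] and U_2m = U_m V_m. The integer M only
   makes the first factor of either product the larger one. *)
Lemma close_pairs_of_lucas (alpha h h' f c : R) (x sigma omega u v Tz a : Z)
    (W : nat -> Z) (j : nat) :
  0 < alpha -> (forall q : Q, alpha <> Q2R q) ->
  1 < h -> (sigma = 1 \/ sigma = -1)%Z -> (omega = 1 \/ omega = -1)%Z ->
  h + h' = IZR x -> h * h' = IZR (- sigma) -> 0 < h - h' -> 0 < f ->
  (forall n, f * IZR (W n) = h ^ n - IZR omega * h' ^ n) ->
  (0 < u)%Z -> (0 < v)%Z -> (0 < Tz)%Z -> 0 < c ->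
  IZR v * alpha = IZR u * (powerRZ h a * c) -> IZR Tz * f = c * (h - h') ->
  exists e : nat, (2 * e + 1 = fermat_prod j)%nat /\ close_pairs alpha h e.
Proof.
  intros Ha Hirr Hh Hsig Hom Hx Hs Hd Hf HW Hu Hv HT Hc Halpha HTf.
  assert (He : (- sigma = 1 \/ - sigma = -1)%Z) by lia.
  assert (Hd' : h - h' <> 0) by lra.
  assert (Hf' : f <> 0) by lra.
  pose proof (lucas_strongly_divisible x sigma omega h h' f W Hsig Hom Hx Hs Hd' Hf' HW) as HSD.
  destruct (lucas_growth h h' f (- sigma) omega W Hh He Hom Hs Hf HW) as [K HK].
  destruct (balanced_factorization _ h K j ltac:(lra) HSD HK) as (e & K1 & He1 & HK1 & Hbal).
  assert (HU : forall n, (h - h') * IZR (lucasU x sigma n) = h ^ n - IZR 1 * h' ^ n).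
  { intros n. rewrite (lucasU_closed x sigma h h') by auto. ring. }
  assert (HV : forall n, 1 * IZR (lucasV x sigma n) = h ^ n - IZR (-1) * h' ^ n).
  { intros n. rewrite (lucasV_closed x sigma h h') by auto. ring. }
  destruct (lucas_growth h h' (h - h') (- sigma) 1 (lucasU x sigma) Hh He ltac:(lia) Hs Hd HU)
    as [KU [HKU HgU]].
  destruct (lucas_growth h h' 1 (- sigma) (-1) (lucasV x sigma) Hh He ltac:(lia) Hs ltac:(lra) HV)
    as [KV [HKV HgV]].
  (* [K1] bounds z/y and [KU * KV] bounds V_m/U_m, so [M] exceeds both ratios. *)
  destruct (archimed (K1 + KU * KV)) as [HM _].
  set (M := up (K1 + KU * KV)) in *.
  assert (HUV : 1 <= KU * KV) by nra.
  assert (HM1 : (0 < M)%Z) by (apply lt_IZR; lra).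
  set (rho := powerRZ h a).
  assert (Hrho : 0 < rho) by (apply powerRZ_lt; lra).
  (* Bounds the two surviving conjugate terms: h'^(2m) gives 1/rho and rho h'^n gives rho, each
     times h^(-n). *)
  set (cE := c / f * (rho + / rho)).
  assert (HcE : 0 < cE).
  { unfold cE. apply Rmult_lt_0_compat; [now apply Rdiv_lt_0_compat|].
    apply Rplus_lt_0_compat; [exact Hrho|now apply Rinv_0_lt_compat]. }
  assert (HuR := IZR_ge_1 u Hu). assert (HvR := IZR_ge_1 v Hv).
  assert (HTR := IZR_ge_1 Tz HT). assert (HMR := IZR_ge_1 M HM1).
  exists e. split; [exact He1|].
  (* The larger factors M v y and M u Tz U_m are inserted in the size bound, with h^(2m) = rho
     h^n. *)
  exists (4 * alpha * (IZR M * IZR v * K1) ^ 2 + 4 * (IZR M * IZR u * IZR Tz * KU) ^ 2 * rho),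
    (4 * (IZR M * IZR u * cE)).
  split.
  { assert (0 < IZR M * IZR v * K1) by (repeat apply Rmult_lt_0_compat; lra).
    apply Rplus_lt_le_0_compat.
    - apply Rmult_lt_0_compat; [lra|]. now apply pow_lt.
    - apply Rmult_le_pos; [|lra]. apply Rmult_le_pos; [lra|]. apply pow2_ge_0. }
  split.
  { assert (0 < IZR M * IZR u) by (apply Rmult_lt_0_compat; lra).
    apply Rmult_lt_0_compat; [lra|]. now apply Rmult_lt_0_compat. }
  intros k0.
  set (P := fermat_prod j) in *.
  (* As P is odd, the summand |a| makes kP + a even. It also makes |a| P + a nonnegative, so the
     even summand yields m >= 1. *)
  set (k := (2 * (k0 + 1) + Z.abs_nat a)%nat).
  assert (Hm : exists m : nat, (1 <= m)%nat /\ (Z.of_nat (k * P) + a = Z.of_nat (2 * m))%Z).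
  { exists ((k0 + 1) * P + Z.to_nat ((Z.of_nat (Z.abs_nat a * P) + a) / 2))%nat.
    assert (HP : (1 <= P)%nat) by lia.
    split; [nia|].
    assert (Hev : ((2 * ((Z.of_nat (Z.abs_nat a * P) + a) / 2) = Z.of_nat (Z.abs_nat a * P) + a) /\
                  0 <= Z.of_nat (Z.abs_nat a * P) + a)%Z).
    { rewrite <- He1, Nat2Z.inj_mul, Nat2Z.inj_add, Nat2Z.inj_mul, Zabs2Nat.id_abs.
      destruct (Z.abs_eq_or_opp a) as [E|E]; rewrite E.
      - replace (a * (Z.of_nat 2 * Z.of_nat e + Z.of_nat 1) + a)%Z with ((a * (Z.of_nat e + 1)) * 2)%Z by lia.
        rewrite Z.div_mul by lia. nia.
      - replace (- a * (Z.of_nat 2 * Z.of_nat e + Z.of_nat 1) + a)%Z with ((- a * Z.of_nat e) * 2)%Z by lia.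
        rewrite Z.div_mul by lia. nia. }
    destruct Hev as [Hev1 Hev2].
    set (w := (Z.of_nat (Z.abs_nat a * P) + a)%Z) in *.
    assert (0 <= w / 2)%Z by (apply Z.div_pos; lia).
    unfold k. rewrite !Nat2Z.inj_mul, !Nat2Z.inj_add, Z2Nat.id, !Nat2Z.inj_mul by lia.
    unfold w in *. rewrite Nat2Z.inj_mul in *. nia. }
  destruct Hm as (m & Hm1 & Hm).
  assert (Hk1 : (1 <= k)%nat) by lia.
  destruct (Hbal k Hk1) as (y & z & Hy & Hz & Hyz & By & Bz & Bzy).
  set (n := (k * P)%nat) in *.
  assert (Hn1 : (1 <= n)%nat) by (unfold n; nia).
  assert (HWn : (0 < W n)%Z) by (apply (lucas_pos h h' f (- sigma) omega W n); auto).
  rewrite Z.abs_eq in Hyz by lia.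
  assert (HUm : (0 < lucasU x sigma m)%Z)
    by (apply (lucas_pos h h' (h - h') (- sigma) 1 _ m); auto).
  assert (HVm : (0 < lucasV x sigma m)%Z)
    by (apply (lucas_pos h h' 1 (- sigma) (-1) _ m); auto; lra).
  destruct (HgU m Hm1) as [LU UU]. destruct (HgV m Hm1) as [LV UV].
  rewrite !Z.abs_eq in LU, UU, LV, UV by lia.
  pose proof (lucasU_double x sigma h h' m Hx Hs Hd') as HUd.
  set (Um := lucasU x sigma m) in *. set (Vm := lucasV x sigma m) in *.
  assert (hm : 0 < h ^ m) by (apply pow_lt; lra).
  assert (hn : 0 < h ^ n) by (apply pow_lt; lra).
  assert (Ehm : h ^ (2 * m) = rho * h ^ n).
  { unfold rho. rewrite !pow_powerRZ, <- powerRZ_add by lra. f_equal. lia. }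
  (* The two products will be M v W_n and M u Tz U_(2m): [M] scales both sides alike. *)
  assert (Hpq1 : (0 < z < M * v * y)%Z).
  { split; [exact Hz|]. apply lt_IZR. rewrite !mult_IZR.
    assert (HyR := IZR_ge_1 y Hy).
    apply Rle_lt_trans with (1 := Bzy).
    apply Rmult_lt_compat_r; [lra|]. nra. }
  assert (Hpq2 : (0 < Vm < M * u * Tz * Um)%Z).
  { split; [exact HVm|]. apply lt_IZR. rewrite !mult_IZR.
    assert (HUR := IZR_ge_1 Um HUm).
    apply Rle_lt_trans with (KU * KV * IZR Um); [nra|].
    apply Rmult_lt_compat_r; [lra|].
    assert (1 <= IZR u * IZR Tz) by nra. nra. }
  destruct (close_values_of_products alpha _ _ _ _ Ha Hirr Hpq1 Hpq2)
    as (t & t' & Vt & Vt' & Htt & Hsize & Hdiff).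
  exists k, t, t'. split; [lia|]. split; [exact Hk1|].
  repeat (split; [assumption|]). split.
  - apply Rle_trans with (1 := Hsize).
    assert (HY : 0 < h ^ (k * (e + 1))) by (apply pow_lt; lra).
    assert (E1 : h ^ (2 * (k * (e + 1))) = (h ^ (k * (e + 1))) ^ 2).
    { rewrite <- pow_mult. f_equal. lia. }
    (* Here n = k(2e+1) <= 2k(e+1), so the balanced side fits within the size of the other. *)
    assert (E2 : (h ^ m) ^ 2 <= rho * h ^ (2 * (k * (e + 1)))).
    { rewrite <- pow_mult. replace (m * 2)%nat with (2 * m)%nat by lia. rewrite Ehm.
      apply Rmult_le_compat_l; [lra|]. apply Rle_pow; [lra|]. unfold n. nia. }
    assert (HyR := IZR_ge_1 y Hy). assert (HUR := IZR_ge_1 Um HUm).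
    rewrite !mult_IZR, Rmult_plus_distr_r. apply Rplus_le_compat.
    + rewrite E1, !Rmult_assoc. apply Rmult_le_compat_l; [lra|].
      apply Rmult_le_compat_l; [lra|]. rewrite <- Rpow_mult_distr. apply pow_incr.
      split; [repeat apply Rmult_le_pos; lra|].
      rewrite !Rmult_assoc. apply Rmult_le_compat_l; [lra|]. apply Rmult_le_compat_l; lra.
    + rewrite !Rmult_assoc. apply Rmult_le_compat_l; [lra|].
      apply Rle_trans with ((IZR M * (IZR u * (IZR Tz * KU))) ^ 2 * (h ^ m) ^ 2).
      * rewrite <- Rpow_mult_distr. apply pow_incr.
        split; [repeat apply Rmult_le_pos; lra|].
        rewrite !Rmult_assoc. repeat (apply Rmult_le_compat_l; [lra|]). exact UU.
      * apply Rmult_le_compat_l; [apply pow2_ge_0|exact E2].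
  - apply Rle_trans with (1 := Hdiff).
    replace (k * (2 * e + 1))%nat with n by (unfold n; nia).
    unfold Rdiv. rewrite !Rmult_assoc. apply Rmult_le_compat_l; [lra|].
    apply (f_equal IZR) in Hyz, HUd. rewrite mult_IZR in Hyz, HUd.
    rewrite !mult_IZR.
    replace (alpha * (IZR M * IZR v * IZR y * IZR z) - IZR M * IZR u * IZR Tz * IZR Um * IZR Vm)
      with (IZR M * (IZR v * alpha * (IZR y * IZR z) - IZR u * (IZR Tz * (IZR Um * IZR Vm)))) by ring.
    rewrite Hyz, <- HUd, Halpha. fold rho.
    (* alpha was chosen so that the powers h^2m cancel and only conjugates remain *)
    assert (Ediff : rho * c * IZR (W n) - IZR Tz * IZR (lucasU x sigma (2 * m)) =
                    c / f * (h' ^ (2 * m) - IZR omega * rho * h' ^ n)).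
    { assert (EW : IZR (W n) = (h ^ n - IZR omega * h' ^ n) / f) by (rewrite <- HW; field; lra).
      assert (EU : IZR (lucasU x sigma (2 * m)) = (h ^ (2 * m) - h' ^ (2 * m)) / (h - h')).
      { rewrite <- (lucasU_closed x sigma h h') by auto. field; lra. }
      assert (ET : IZR Tz = c * (h - h') / f) by (rewrite <- HTf; field; lra).
      rewrite EW, EU, ET, Ehm. field. lra. }
    replace (IZR u * (rho * c) * IZR (W n) - IZR u * (IZR Tz * IZR (lucasU x sigma (2 * m))))
      with (IZR u * (rho * c * IZR (W n) - IZR Tz * IZR (lucasU x sigma (2 * m)))) by ring.
    rewrite Ediff, !Rabs_mult, (Rabs_pos_eq (IZR M)), (Rabs_pos_eq (IZR u)), (Rabs_pos_eq (c / f)) by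
      (try lra; apply Rlt_le, Rdiv_lt_0_compat; lra).
    apply Rmult_le_compat_l; [lra|]. apply Rmult_le_compat_l; [lra|].
    unfold cE. rewrite (Rmult_assoc (c / f) (rho + / rho)). apply Rmult_le_compat_l; [apply Rlt_le, Rdiv_lt_0_compat; lra|].
    pose proof (conj_pow_bound h h' (- sigma) n Hh He Hs) as B1.
    pose proof (conj_pow_bound h h' (- sigma) (2 * m) Hh He Hs) as B2.
    rewrite Ehm, Rinv_mult in B2.
    apply Rabs_le. destruct Hom as [-> | ->]; nra.
Qed.

(** * From close values to the minimal gap *)

(** With Y = h^(k(e+1)), some N of order Y^2 exceeds the index of the lower value, while the gap is
    O((Y^2)^beta) with beta = -1 + 1/(2(e+1)). *)
Lemma delta_min_of_close_pairs (alpha h eps : R) (e : nat) :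
  0 < alpha -> (forall q : Q, alpha <> Q2R q) -> 1 < h -> close_pairs alpha h e ->
  / INR (2 * (e + 1)) <= eps ->
  exists C : R, 0 < C /\
    forall N0 : nat, exists N : nat, (N0 <= N)%nat /\ (2 <= N)%nat /\
      delta_min alpha N <= C * Rpower (INR N) (-1 + eps).
Proof.
  intros Ha Hirr Hh (C1 & C2 & HC1 & HC2 & Hclose) Heps.
  (* Chosen so that [C3 * Y] bounds [bnd alpha t']; the 2 pays for two roundings and is absorbed by
     Y >= 1. *)
  set (C3 := sqrt (C1 / alpha) + sqrt C1 + 2).
  assert (HC3 : 2 <= C3).
  { unfold C3. pose proof (sqrt_pos (C1 / alpha)). pose proof (sqrt_pos C1). lra. }
  (* N is at most (C3 Y)^2 + 1, hence at most C4 Y^2. *)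
  set (C4 := C3 ^ 2 + 1).
  assert (HC4 : 0 < C4) by (unfold C4; nra).
  set (beta := -1 + / INR (2 * (e + 1))).
  assert (Hd : 1 <= INR (2 * (e + 1))) by (change 1 with (INR 1); apply le_INR; lia).
  assert (Hbeta : beta <= 0).
  { unfold beta. assert (/ INR (2 * (e + 1)) <= 1); [|lra].
    rewrite <- Rinv_1. apply Rinv_le_contravar; lra. }
  exists (C2 / Rpower C4 beta). split.
  { apply Rdiv_lt_0_compat; [exact HC2|apply exp_pos]. }
  intros N0.
  destruct (Pow_x_infinity h ltac:(rewrite Rabs_pos_eq; lra) (INR N0)) as [k0 Hk0].
  destruct (Hclose k0) as (k & t & t' & Hk & Hk1 & Vt & Vt' & Htt & Hsize & Hdiff).
  set (Y := h ^ (k * (e + 1))).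
  assert (HY1 : 1 <= Y) by (apply pow_R1_Rle; lra).
  assert (EY : h ^ (2 * (k * (e + 1))) = Y ^ 2).
  { unfold Y. rewrite <- pow_mult. f_equal. lia. }
  rewrite EY in Hsize.
  assert (HYN : INR N0 <= Y).
  { specialize (Hk0 (k * (e + 1))%nat ltac:(nia)). rewrite Rabs_pos_eq in Hk0.
    - unfold Y. lra.
    - apply pow_le; lra. }
  assert (Hbnd : INR (bnd alpha t') <= C3 * Y).
  { apply Rle_trans with (1 := INR_bnd_le alpha t' Ha).
    assert (sqrt t' <= sqrt C1 * Y).
    { rewrite <- (sqrt_pow2 Y) at 1 by lra. rewrite <- sqrt_mult_alt by lra.
      now apply sqrt_le_1_alt. }
    assert (sqrt (t' / alpha) <= sqrt (C1 / alpha) * Y).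
    { rewrite <- (sqrt_pow2 Y) at 1 by lra.
      assert (0 < C1 / alpha) by now apply Rdiv_lt_0_compat.
      rewrite <- sqrt_mult_alt by lra. apply sqrt_le_1_alt.
      replace (C1 / alpha * Y ^ 2) with (C1 * Y ^ 2 / alpha) by (field; lra).
      apply Rmult_le_compat_r; [|exact Hsize]. apply Rlt_le, Rinv_0_lt_compat, Ha. }
    unfold C3. nra. }
  clearbody C3.
  destruct (archimed ((C3 * Y) ^ 2)) as [A1 A2].
  set (N := Z.to_nat (up ((C3 * Y) ^ 2))).
  (* Yields both N >= N0 and N >= 2. *)
  assert (HCY : 4 * Y <= (C3 * Y) ^ 2).
  { replace ((C3 * Y) ^ 2) with (C3 ^ 2 * Y * Y) by ring.
    assert (HC32 : 4 <= C3 ^ 2) by (simpl; nra).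
    apply Rle_trans with (C3 ^ 2 * Y); [apply Rmult_le_compat_r; lra|].
    rewrite <- (Rmult_1_r (C3 ^ 2 * Y)) at 1. apply Rmult_le_compat_l; [|exact HY1].
    apply Rmult_le_pos; lra. }
  assert (EN : INR N = IZR (up ((C3 * Y) ^ 2))).
  { unfold N. rewrite INR_IZR_INZ, Z2Nat.id; [reflexivity|]. apply le_IZR. lra. }
  exists N. split; [apply INR_le; lra|]. split; [apply INR_le; simpl (INR 2); lra|].
  apply Rle_trans with (t' - t).
  { apply delta_min_le; auto. apply INR_lt. rewrite mult_INR, EN.
    apply Rle_lt_trans with ((C3 * Y) ^ 2); [|exact A1].
    pose proof (pos_INR (bnd alpha t')). nra. }
  apply Rle_trans with (1 := Hdiff).
  apply Rle_trans with (C2 / Rpower C4 beta * Rpower (INR N) beta).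
  2:{ apply Rmult_le_compat_l.
      - apply Rlt_le, Rdiv_lt_0_compat; [exact HC2|apply exp_pos].
      - apply Rle_Rpower; unfold beta; lra. }
  assert (HNle : INR N <= C4 * Y ^ 2) by (unfold C4; nra).
  assert (Hpow : Rpower C4 beta * / h ^ (k * (2 * e + 1)) <= Rpower (INR N) beta).
  { replace (/ h ^ (k * (2 * e + 1))) with (Rpower (Y ^ 2) beta).
    - rewrite Rpower_mult_distr by nra.
      (* Powers with the nonpositive exponent [beta] decrease, so monotonicity is applied to -beta
         and inverted. *)
      replace beta with (- (- beta)) by ring. rewrite !(Rpower_Ropp _ (- beta)).
      apply Rinv_le_contravar; [apply exp_pos|]. apply Rle_Rpower_l; lra.
    - rewrite <- EY, <- !Rpower_pow, Rpower_mult, <- Rpower_Ropp by lra. f_equal.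
      unfold beta. rewrite !mult_INR in *. rewrite !plus_INR, !mult_INR in *. simpl (INR 2) in *. simpl (INR 1) in *.
      pose proof (pos_INR e). field. lra. }
  apply Rle_trans with (C2 / Rpower C4 beta * (Rpower C4 beta * / h ^ (k * (2 * e + 1)))).
  - apply Req_le. field. split; [apply pow_nonzero; lra|]. apply Rgt_not_eq, exp_pos.
  - apply Rmult_le_compat_l; [|exact Hpow].
    apply Rlt_le, Rdiv_lt_0_compat; [exact HC2|apply exp_pos].
Qed.

(** * Normalization of the unit and choice of parameters *)

Lemma fermat_prod_gt (j : nat) : (j < fermat_prod j)%nat.
Proof. induction j as [|j IH]; simpl; nia. Qed.

Definition rational (y : R) : Prop := exists q : Q, y = Q2R q.

Lemma rational_IZR (z : Z) : rational (IZR z).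
Proof. exists (inject_Z z). unfold Q2R; simpl. field. Qed.

Lemma rational_mult (y z : R) : rational y -> rational z -> rational (y * z).
Proof. intros [p ->] [q ->]. exists (p * q)%Q. now rewrite Q2R_mult. Qed.

Lemma rational_inv (y : R) : rational y -> rational (/ y).
Proof.
  intros [p ->]. destruct (Qeq_dec p 0) as [E|E].
  - exists 0%Q. rewrite (Qeq_eqR _ _ E). unfold Q2R; simpl. rewrite Rmult_0_l. apply Rinv_0.
  - exists (/ p)%Q. now rewrite Q2R_inv.
Qed.

Lemma rational_pow (y : R) (n : nat) : rational y -> rational (y ^ n).
Proof.
  intros Hy. induction n as [|n IH]; simpl; [apply (rational_IZR 1)|now apply rational_mult].
Qed.

Lemma rational_powerRZ (y : R) (n : Z) : rational y -> rational (powerRZ y n).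
Proof.
  intros Hy. destruct n; simpl.
  - apply (rational_IZR 1).
  - now apply rational_pow.
  - now apply rational_inv, rational_pow.
Qed.

Lemma powerRZ_unit (e n : Z) : (e = 1 \/ e = -1)%Z ->
  exists e' : Z, (e' = 1 \/ e' = -1)%Z /\ powerRZ (IZR e) n = IZR e'.
Proof.
  intros He. destruct n as [|p|p]; simpl.
  - exists 1%Z. auto.
  - exists (e ^ Z.of_nat (Pos.to_nat p))%Z. split; [now apply unit_pow|apply pow_IZR].
  - exists (e ^ Z.of_nat (Pos.to_nat p))%Z. split; [now apply unit_pow|].
    rewrite pow_IZR. destruct (unit_pow e (Pos.to_nat p) He) as [-> | ->]; field.
Qed.

(* For x < 0 the given unit is, up to sign, the inverse of the one attached to -x. *)
Lemma unit_gt_1 (x sigma a : Z) (s : R) :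
  x <> 0%Z -> (sigma = 1 \/ sigma = -1)%Z -> 0 < s -> s ^ 2 = IZR x ^ 2 + 4 * IZR sigma ->
  exists (h h' : R) (x' a' e : Z), 1 < h /\ h + h' = IZR x' /\ h * h' = IZR (- sigma) /\
    h - h' = s /\ (e = 1 \/ e = -1)%Z /\ powerRZ ((IZR x + s) / 2) a = IZR e * powerRZ h a'.
Proof.
  intros Hx Hsig Hs Es.
  (* Here y stands for |x|. If sigma = -1, then s > 0 forces |x| >= 3. *)
  assert (Hgt : forall y : Z, (0 < y)%Z -> IZR y ^ 2 = IZR x ^ 2 -> 1 < (IZR y + s) / 2).
  { intros y Hy Ey. rewrite <- Ey in Es. destruct Hsig as [-> | ->].
    - assert (1 <= IZR y) by (apply IZR_ge_1; lia). nra.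
    - assert (IZR y ^ 2 > 4) by nra.
      assert (2 < y)%Z by (apply lt_IZR; assert (1 <= IZR y) by (apply IZR_ge_1; lia); nra).
      assert (3 <= IZR y) by (apply IZR_le; lia). nra. }
  rewrite opp_IZR.
  destruct (Z.lt_trichotomy x 0) as [H|[H|H]]; [|contradiction|].
  - pose proof (Hgt (- x)%Z ltac:(lia)) as Hh. rewrite opp_IZR in Hh.
    specialize (Hh ltac:(ring)).
    destruct (powerRZ_unit sigma a Hsig) as (e & He & Ee).
    exists ((- IZR x + s) / 2), ((- IZR x - s) / 2), (- x)%Z, (- a)%Z, e.
    rewrite opp_IZR, <- Ee.
    split; [lra|]. split; [lra|]. split; [nra|]. split; [lra|]. split; [exact He|].
    (* The product of (x + s)/2 and (-x + s)/2 is (s^2 - x^2)/4 = sigma. *)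
    replace ((IZR x + s) / 2) with (IZR sigma * / ((- IZR x + s) / 2)).
    + rewrite powerRZ_mult, powerRZ_inv', powerRZ_neg'. reflexivity.
    + apply Rmult_eq_reg_r with ((- IZR x + s) / 2); [|lra].
      rewrite Rmult_assoc, Rinv_l by lra. nra.
  - exists ((IZR x + s) / 2), ((IZR x - s) / 2), x, a, 1%Z.
    assert (Hh : 1 < (IZR x + s) / 2) by (apply Hgt; [exact H|reflexivity]).
    split; [lra|]. split; [lra|]. split; [nra|]. split; [lra|]. split; [auto|ring].
Qed.

Theorem theorem6p1 (a : Z) (b : nat) (x : Z) (sigma : Z) (r : Q) (alpha : R) :
  (b = 0%nat \/ b = 1%nat) ->
  x <> 0%Z ->
  (sigma = 1%Z \/ sigma = (-1)%Z) ->
  ~ (r == 0)%Q ->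
  alpha = Q2R r
          * powerRZ ((IZR x + sqrt (IZR x ^ 2 + 4 * IZR sigma)) / 2) a
          * (sqrt (IZR x ^ 2 + 4 * IZR sigma)) ^ b ->
  0 < alpha ->
  quadratic_irrational alpha ->
  forall eps : R, 0 < eps ->
    exists C : R, 0 < C /\
      forall N0 : nat, exists N : nat, (N0 <= N)%nat /\ (2 <= N)%nat /\
        delta_min alpha N <= C * Rpower (INR N) (-1 + eps).
Proof.
  intros Hb Hx Hsig _ Halpha Ha [Hirr _] eps Heps.
  set (s := sqrt (IZR x ^ 2 + 4 * IZR sigma)) in *.
  assert (Hs : 0 < s).
  { destruct (Rle_lt_or_eq_dec 0 s (sqrt_pos _)) as [H|H]; [exact H|].
    (* If s = 0, every factor of alpha is rational. This also covers a negative radicand, where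
       [sqrt] is 0 by convention. *)
    exfalso. assert (Hr : rational alpha); [|destruct Hr as [q Hq]; now apply (Hirr q)].
    rewrite Halpha, <- H. apply rational_mult; [apply rational_mult|].
    - now exists r.
    - apply rational_powerRZ. rewrite Rplus_0_r. apply rational_mult; [apply rational_IZR|].
      apply rational_inv, rational_IZR.
    - apply rational_pow, (rational_IZR 0). }
  assert (HD : 0 <= IZR x ^ 2 + 4 * IZR sigma).
  { destruct (Rle_lt_dec 0 (IZR x ^ 2 + 4 * IZR sigma)) as [H|H]; [exact H|].
    unfold s in Hs. rewrite sqrt_neg_0 in Hs; lra. }
  assert (Es : s ^ 2 = IZR x ^ 2 + 4 * IZR sigma) by now apply pow2_sqrt.
  assert (ED : IZR (x ^ 2 + 4 * sigma) = s ^ 2).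
  { rewrite Es, plus_IZR, mult_IZR, (pow_IZR x 2). reflexivity. }
  destruct (unit_gt_1 x sigma a s Hx Hsig Hs Es)
    as (h & h' & x' & a' & e & Hh & Hsum & Hprod & Hdiff & He & Epow).
  rewrite Epow in Halpha.
  set (c := s ^ b) in *.
  assert (Hc : 0 < c) by now apply pow_lt.
  assert (Hp : 0 < powerRZ h a') by (apply powerRZ_lt; lra).
  assert (Hv : 0 < IZR (Zpos (Qden r))) by (apply IZR_lt; lia).
  assert (Ealpha : IZR (Zpos (Qden r)) * alpha = IZR (e * Qnum r) * (powerRZ h a' * c)).
  { rewrite Halpha, mult_IZR. unfold Q2R. field. lra. }
  (* Positivity of alpha forces the sign of the unit to agree with that of [r]. *)
  assert (Hu : (0 < e * Qnum r)%Z).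
  { apply lt_IZR. apply Rmult_lt_reg_r with (powerRZ h a' * c).
    - now apply Rmult_lt_0_compat.
    - rewrite Rmult_0_l, <- Ealpha. now apply Rmult_lt_0_compat. }
  assert (Hd : h - h' <> 0) by lra.
  (* Since 2(n+1) = [fermat_prod j] + 1 exceeds j > 1/eps, the loss in the exponent is below eps. *)
  set (j := Z.to_nat (up (/ eps))).
  assert (Hclose : exists n : nat, (2 * n + 1 = fermat_prod j)%nat /\ close_pairs alpha h n).
  { destruct Hb as [-> | ->].
    (* For b = 0, W = U, f = h - h', c = 1 and Tz = 1. *)
    - apply (close_pairs_of_lucas alpha h h' (h - h') c x' sigma 1 (e * Qnum r) (Zpos (Qden r)) 1 a'
               (lucasU x' sigma)); auto; try lia; try lra.
      intros n. rewrite (lucasU_closed x' sigma h h') by auto. ring.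
    (* For b = 1, W = V, f = 1 and c = s = h - h', so Tz must be s^2, which is an integer. *)
    - apply (close_pairs_of_lucas alpha h h' 1 c x' sigma (-1) (e * Qnum r) (Zpos (Qden r))
               (x ^ 2 + 4 * sigma) a' (lucasV x' sigma)); auto; try lia; try lra.
      + intros n. rewrite (lucasV_closed x' sigma h h') by auto. ring.
      + apply lt_IZR. rewrite ED. now apply pow_lt.
      + rewrite ED, Hdiff. unfold c. ring. }
  destruct Hclose as (n & Hn & Hclose).
  apply (delta_min_of_close_pairs alpha h eps n); auto.
  destruct (archimed (/ eps)) as [Hup _].
  assert (0 < / eps) by now apply Rinv_0_lt_compat.
  rewrite <- (Rinv_inv eps). apply Rinv_le_contravar; [assumption|].
  apply Rle_trans with (INR j).
  - unfold j. rewrite INR_IZR_INZ, Z2Nat.id; [lra|]. apply le_IZR. lra.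
  - apply le_INR. pose proof (fermat_prod_gt j). lia.
Qed.
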